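(* Let $B\times_fF$ be a degenerate warped product, let $X,Y,Z\in\Gamma(TB)$ and $U,V,W\in\Gamma(TF)$ (lifted to $B\times F$), and let $P\in\Gamma(TB)$ (lifted). Let $\widehat{\mathcal K}$ be the semi-symmetric non-metric Koszul form on $B\times_fF$ associated with $P$, let $\widehat{\mathcal K}_B$ be the lift of the semi-symmetric non-metric Koszul form of $(B,g_B)$ associated with $P$, and let $\mathcal K_F$ be the lift of the Koszul form of $(F,g_F)$. Then: (1) $\widehat{\mathcal K}(X,Y,Z)=\widehat{\mathcal K}_B(X,Y,Z)$; (2) $\widehat{\mathcal K}(X,Y,W)=\widehat{\mathcal K}(X,W,Y)=\widehat{\mathcal K}(W,X,Y)=0$; (3) $\widehat{\mathcal K}(X,V,W)=-\widehat{\mathcal K}(V,W,X)=f\,g_F(V,W)\,X(f)$; (4) $\widehat{\mathcal K}(V,X,W)=f\,g_F(V,W)\,X(f)+f^2g_B(X,P)g_F(V,W)$; (5) $\widehat{\mathcal K}(U,V,W)=f^2\,\mathcal K_F(U,V,W)$.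
   Context: A singular semi-Riemannian manifold is a smooth manifold with a smooth symmetric $(0,2)$-tensor field $g=\langle\cdot,\cdot\rangle$, possibly degenerate and of varying signature. Its Koszul form is $\mathcal K(X,Y,Z)=\tfrac12\{X\langle Y,Z\rangle+Y\langle Z,X\rangle-Z\langle X,Y\rangle-\langle X,[Y,Z]\rangle+\langle Y,[Z,X]\rangle+\langle Z,[X,Y]\rangle\}$, and the semi-symmetric non-metric Koszul form associated with a vector field $P$ is $\widehat{\mathcal K}(X,Y,Z)=\mathcal K(X,Y,Z)+g(Y,P)g(X,Z)$. Let $(B,g_B)$, $(F,g_F)$ be singular semi-Riemannian manifolds and $f\in C^\infty(B)$ (which may vanish at some points). The (degenerate) warped product $B\times_fF$ is $B\times F$ with the metric $\pi_B^*(g_B)+(f\circ\pi_B)^2\pi_F^*(g_F)$, where $\pi_B,\pi_F$ are the projections. Functions, vector fields and forms on $B$ and $F$ are identified with their lifts to $B\times F$. *)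

(* Defs.v *)
From HB Require Import structures.
From mathcomp Require Import all_boot all_order all_algebra.
From mathcomp Require Import all_classical all_reals.
From mathcomp Require Import topology normedtype derive.

Set Implicit Arguments.
Unset Strict Implicit.
Unset Printing Implicit Defensive.

Import Order.TTheory GRing.Theory Num.Theory.
Import numFieldNormedType.Exports.

Local Open Scope classical_set_scope.
Local Open Scope ring_scope.

(* On an open set [U] of R^n this is the usual C^k: all iterated directional
   derivatives of order at most [k] exist and are continuous on [U]. *)
Fixpoint Ck (R : realType) (V W : normedModType R) (k : nat) (U : set V)
    (f : V -> W) : Prop :=
  (forall x, U x -> {for x, continuous f}) /\
  (if k is k'.+1 then
     forall v, (forall x, U x -> derivable f x v) /\ Ck k' U (fun x => 'D_v f x)
   else True).

Definition smooth_on (R : realType) (V W : normedModType R) (U : set V)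
    (f : V -> W) : Prop := forall k, Ck k U f.

Section CkTheory.
Context {R : realType}.
Implicit Types (V W : normedModType R).

Lemma Ck_continuous V W k (U : set V) (f : V -> W) x :
  Ck k U f -> U x -> {for x, continuous f}.
Proof. by case: k => [|k] [fc _]; exact: fc. Qed.

Lemma eq_derive_near V W (f g : V -> W) x v :
  (\forall y \near x, f y = g y) -> 'D_v f x = 'D_v g x.
Proof.
have [->|v0] := eqVneq v 0; first by rewrite !derive0.
exact: near_eq_derive.
Qed.

Lemma eq_derivable_near V W (f g : V -> W) x v :
  (\forall y \near x, f y = g y) -> derivable f x v -> derivable g x v.
Proof.
have [->|v0] := eqVneq v 0; first by move=> *; exact: derivable0.
exact: near_eq_derivable.
Qed.

Lemma eq_derive_open V W (U : set V) (f g : V -> W) x v :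
  open U -> U x -> (forall y, U y -> f y = g y) -> 'D_v f x = 'D_v g x.
Proof.
move=> oU Ux fg; apply: eq_derive_near.
by apply: filterS (open_nbhs_nbhs (conj oU Ux)) => y; exact: fg.
Qed.

Lemma eq_derivable_open V W (U : set V) (f g : V -> W) x v :
  open U -> U x -> (forall y, U y -> f y = g y) ->
  derivable f x v -> derivable g x v.
Proof.
move=> oU Ux fg; apply: eq_derivable_near.
by apply: filterS (open_nbhs_nbhs (conj oU Ux)) => y; exact: fg.
Qed.

Lemma eq_continuous_open V W (U : set V) (f g : V -> W) x :
  open U -> U x -> (forall y, U y -> f y = g y) ->
  {for x, continuous f} -> {for x, continuous g}.
Proof.
move=> oU Ux fg fc; suff : g @ x --> g x by [].
rewrite -(fg _ Ux); apply: cvg_trans fc; apply: near_eq_cvg.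
by apply: filterS (open_nbhs_nbhs (conj oU Ux)) => y; exact: fg.
Qed.

Lemma eq_Ck V W k (U : set V) (f g : V -> W) :
  open U -> (forall y, U y -> f y = g y) -> Ck k U f -> Ck k U g.
Proof.
move=> oU; elim: k f g => [|k IH] f g fg /= [fc fD]; split => //.
- by move=> x Ux; exact: (eq_continuous_open oU Ux fg (fc x Ux)).
- by move=> x Ux; exact: (eq_continuous_open oU Ux fg (fc x Ux)).
- move=> v; have [fd fC] := fD v; split => [x Ux|].
    exact: (eq_derivable_open oU Ux fg (fd x Ux)).
  by apply: IH fC => y Uy; exact: eq_derive_open Uy fg.
Qed.

Lemma Ck_sub V W k (U U' : set V) (f : V -> W) :
  U' `<=` U -> Ck k U f -> Ck k U' f.
Proof.
move=> UU'; elim: k f => [|k IH] f /= [fc fD]; split => //.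
- by move=> x /UU'; exact: fc.
- by move=> x /UU'; exact: fc.
- move=> v; have [fd fC] := fD v; split; last exact: IH.
  by move=> x /UU'; exact: fd.
Qed.

Lemma Ck_cst V W k (U : set V) (c : W) : Ck k U (fun=> c).
Proof.
elim: k c => [|k IH] c; split=> //; try by move=> x _; exact: cvg_cst.
move=> v; split => [x _|]; first exact: derivable_cst.
rewrite (_ : (fun x : V => 'D_v (fun=> c) x) = fun=> 0); first exact: IH.
by apply/funext => x; exact: derive_cst.
Qed.

Lemma Ck_pred V W k (U : set V) (f : V -> W) : Ck k.+1 U f -> Ck k U f.
Proof.
elim: k f => [|k IH] f; first by case.
by move=> [fc fD]; split => // v; have [fd fC] := fD v; split => //; exact: IH.
Qed.

Lemma CkD V W k (U : set V) (f g : V -> W) : open U ->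
  Ck k U f -> Ck k U g -> Ck k U (fun x => f x + g x).
Proof.
move=> oU; elim: k f g => [|k IH] f g /= [fc fD] [gc gD]; split => //.
- by move=> x Ux; exact: cvgD (fc x Ux) (gc x Ux).
- by move=> x Ux; exact: cvgD (fc x Ux) (gc x Ux).
- move=> v; have [fd fC] := fD v; have [gd gC] := gD v; split => [x Ux|].
    exact: derivableD (fd x Ux) (gd x Ux).
  apply: eq_Ck (IH _ _ fC gC) => // y Uy.
  exact/esym/(deriveD (fd y Uy) (gd y Uy)).
Qed.

Lemma CkM V k (U : set V) (f g : V -> R) : open U ->
  Ck k U f -> Ck k U g -> Ck k U (fun x => f x * g x).
Proof.
move=> oU; elim: k f g => [|k IH] f g Cf Cg.
  by have [fc _] := Cf; have [gc _] := Cg; split => // x Ux;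
    exact: cvgM (fc x Ux) (gc x Ux).
have [fc fD] := Cf; have [gc gD] := Cg; split => [x Ux|v].
  exact: cvgM (fc x Ux) (gc x Ux).
have [fd fC] := fD v; have [gd gC] := gD v; split => [x Ux|].
  exact: derivableM (fd x Ux) (gd x Ux).
apply: eq_Ck (CkD oU (IH _ _ (Ck_pred Cf) gC) (IH _ _ (Ck_pred Cg) fC)) => //.
by move=> y Uy; exact/esym/(deriveM (fd y Uy) (gd y Uy)).
Qed.

Lemma quotient_complin V V' W (l : {linear V' -> V}) (f : V -> W) x v :
  (fun h : R => h^-1 *: (((f \o l) \o shift x) (h *: v) - (f \o l) x)) =
  (fun h : R => h^-1 *: ((f \o shift (l x)) (h *: l v) - f (l x))).
Proof. by apply/funext => h /=; rewrite linearP. Qed.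

Lemma derive_complin V V' W (l : {linear V' -> V}) (f : V -> W) x v :
  'D_v (f \o l) x = 'D_(l v) f (l x).
Proof.
by rewrite /derive quotient_complin.
Qed.

Lemma derivable_complinE V V' W (l : {linear V' -> V}) (f : V -> W) x v :
  derivable (f \o l) x v = derivable f (l x) (l v).
Proof.
by rewrite /derivable quotient_complin.
Qed.

Lemma Ck_complin V V' W k (U : set V) (l : {linear V' -> V}) (f : V -> W) :
  continuous l -> Ck k U f -> Ck k (l @^-1` U) (f \o l).
Proof.
move=> lc; elim: k f => [|k IH] f /= [fc fD]; split => //.
- by move=> x Ux; apply: continuous_comp; [exact: lc|exact: fc].
- by move=> x Ux; apply: continuous_comp; [exact: lc|exact: fc].
- move=> v; have [fd fC] := fD (l v); split => [x Ux|].
    by rewrite derivable_complinE; exact: fd.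
  rewrite (_ : (fun x => 'D_v (f \o l) x) = (fun x => 'D_(l v) f x) \o l).
    exact: IH.
  by apply/funext => x; exact: derive_complin.
Qed.

Section row.
Context (V : normedModType R) (m n : nat).
Implicit Types (f : V -> 'rV[R]_m) (g : V -> 'rV[R]_n).

Lemma continuous_row (T : topologicalType) (f : T -> 'rV[R]_m)
    (g : T -> 'rV[R]_n) x : {for x, continuous f} -> {for x, continuous g} ->
  {for x, continuous (fun x => row_mx (f x) (g x))}.
Proof.
move=> fc gc; apply/cvgrPdist_le => e e0.
move/cvgrPdist_le : fc => /(_ e e0) fc; move/cvgrPdist_le : gc => /(_ e e0) gc.
near=> y.
rewrite opp_row_mx add_row_mx /Num.Def.normr/= mx_normrE.
apply: bigmax_le (ltW e0) _ => -[i j] _ /=; rewrite !mxE.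
case: splitP => k _; rewrite mxE.
- have : `|f x - f y| <= e by near: y.
  rewrite {1}/Num.Def.normr/= mx_normrE => /bigmax_leP [_].
  by move=> /(_ (i, k) isT); rewrite !mxE.
- have : `|g x - g y| <= e by near: y.
  rewrite {1}/Num.Def.normr/= mx_normrE => /bigmax_leP [_].
  by move=> /(_ (i, k) isT); rewrite !mxE.
Unshelve. all: by end_near. Qed.

Lemma derivable_row f g x v : derivable f x v -> derivable g x v ->
  derivable (fun x => row_mx (f x) (g x)) x v.
Proof.
move=> /derivable_mxP fd /derivable_mxP gd; apply/derivable_mxP => i j.
rewrite -(fintype.splitK j); case: (fintype.split j) => k /=.
- by under eq_fun do rewrite row_mxEl; exact: fd.
- by under eq_fun do rewrite row_mxEr; exact: gd.
Qed.

Lemma derive_row f g x v : derivable f x v -> derivable g x v ->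
  'D_v (fun x => row_mx (f x) (g x)) x = row_mx ('D_v f x) ('D_v g x).
Proof.
move=> fd gd; rewrite derive_mx; last exact: derivable_row.
apply/rowP => j; rewrite [LHS]mxE -(fintype.splitK j); case: (fintype.split j) => k /=.
- by rewrite row_mxEl (derive_mx fd) mxE; under eq_fun do rewrite row_mxEl.
- by rewrite row_mxEr (derive_mx gd) mxE; under eq_fun do rewrite row_mxEr.
Qed.

Lemma Ck_row k (U : set V) f g : open U ->
  Ck k U f -> Ck k U g -> Ck k U (fun x => row_mx (f x) (g x)).
Proof.
move=> oU; elim: k f g => [|k IH] f g /= [fc fD] [gc gD]; split => //.
- by move=> x Ux; exact: continuous_row (fc x Ux) (gc x Ux).
- by move=> x Ux; exact: continuous_row (fc x Ux) (gc x Ux).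
- move=> v; have [fd fC] := fD v; have [gd gC] := gD v; split => [x Ux|].
    exact: derivable_row (fd x Ux) (gd x Ux).
  by apply: eq_Ck (IH _ _ fC gC) => // y Uy; rewrite derive_row; auto.
Qed.

End row.
End CkTheory.

(* A chart, with its inverse as a total function meaningful on [cimg] only. *)
Record chart (R : realType) (n : nat) (M : topologicalType) := Chart {
  cdom : set M;
  cimg : set 'rV[R]_n;
  cmap : M -> 'rV[R]_n;
  cinv : 'rV[R]_n -> M;
  cdom_open : open cdom;
  cimg_open : open cimg;
  cmap_img : forall p, cdom p -> cimg (cmap p);
  cinv_dom : forall x, cimg x -> cdom (cinv x);
  cmapK : forall p, cdom p -> cinv (cmap p) = p;
  cinvK : forall x, cimg x -> cmap (cinv x) = x;
  cmap_continuous : forall p, cdom p -> {for p, continuous cmap};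
  cinv_continuous : forall x, cimg x -> {for x, continuous cinv} }.

Definition overlap (R : realType) (n : nat) (M : topologicalType)
  (a b : chart R n M) : set 'rV[R]_n := cimg a `&` cinv a @^-1` cdom b.

Lemma overlap_open (R : realType) (n : nat) (M : topologicalType)
  (a b : chart R n M) : open (overlap a b).
Proof.
rewrite openE => x [ax bx].
have ax' : nbhs x (cimg a) by apply: open_nbhs_nbhs; split=> //; exact: cimg_open.
have bx' : nbhs (cinv a x) (cdom b).
  by apply: open_nbhs_nbhs; split=> //; exact: cdom_open.
exact: filterI ax' (cinv_continuous ax bx').
Qed.

Definition transition (R : realType) (n : nat) (M : topologicalType)
  (a b : chart R n M) (x : 'rV[R]_n) : 'rV[R]_n := cmap b (cinv a x).

(* Smooth manifolds without boundary, of pure dimension [n]. The atlas need not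
   be maximal. Each point comes with a preferred chart of the atlas, which only
   serves to represent tangent vectors by elements of R^n, see below. *)
Record smoothManifold (R : realType) (n : nat) := SmoothManifold {
  mcarrier :> topologicalType;
  m_hausdorff : hausdorff_space mcarrier;
  m_second_countable : @second_countable mcarrier;
  atlas : set (chart R n mcarrier);
  atlas_compat : forall a b, atlas a -> atlas b ->
    smooth_on (overlap a b) (transition a b);
  chart_at : mcarrier -> chart R n mcarrier;
  chart_at_atlas : forall p, atlas (chart_at p);
  chart_at_dom : forall p, cdom (chart_at p) p }.

Section Manifold.
Context {R : realType} {n : nat} (M : smoothManifold R n).

Definition smooth_fun (h : M -> R) : Prop :=
  forall a, atlas a -> smooth_on (cimg a) (fun x => h (cinv a x)).

(* A vector of the tangent space at [p] is represented by its components
   in [chart_at p]. [tcoord a p v] are the components in the chart [a]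
   of the tangent vector [v] at [p]; [tvec a p w] is the tangent vector at [p]
   whose components in the chart [a] are [w]. *)
Definition tcoord (a : chart R n M) (p : M) (v : 'rV[R]_n) : 'rV[R]_n :=
  'D_v (transition (chart_at p) a) (cmap (chart_at p) p).

Definition tvec (a : chart R n M) (p : M) (w : 'rV[R]_n) : 'rV[R]_n :=
  'D_w (transition a (chart_at p)) (cmap a p).

(* Local representation of a section of the tangent bundle. *)
Definition section_rep (X : M -> 'rV[R]_n) (a : chart R n M) (x : 'rV[R]_n) :
  'rV[R]_n := tcoord a (cinv a x) (X (cinv a x)).

Definition smooth_section (X : M -> 'rV[R]_n) : Prop :=
  forall a, atlas a -> smooth_on (cimg a) (section_rep X a).

Record vfield := VField {
  vf_section :> M -> 'rV[R]_n;
  vf_smooth : smooth_section vf_section }.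

(* The function X(h). *)
Definition vact (X : M -> 'rV[R]_n) (h : M -> R) (p : M) : R :=
  'D_(X p) (fun x => h (cinv (chart_at p) x)) (cmap (chart_at p) p).

(* The Lie bracket: [X,Y]^j = X^i d_i Y^j - Y^i d_i X^j in [chart_at p]. *)
Definition lie_bracket (X Y : M -> 'rV[R]_n) (p : M) : 'rV[R]_n :=
  'D_(X p) (section_rep Y (chart_at p)) (cmap (chart_at p) p) -
  'D_(Y p) (section_rep X (chart_at p)) (cmap (chart_at p) p).

(* Smooth symmetric (0,2)-tensor fields, without any condition on the rank
   or the signature. *)
Record singularMetric := SingularMetric {
  mform :> forall p : M, 'rV[R]_n -> 'rV[R]_n -> R;
  mform_sym : forall p u v, mform p u v = mform p v u;
  mform_linear : forall p (c : R) u u' v,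
    mform p (c *: u + u') v = c * mform p u v + mform p u' v;
  mform_smooth : forall a, atlas a -> forall w w',
    smooth_on (cimg a) (fun x =>
      mform (cinv a x) (tvec a (cinv a x) w) (tvec a (cinv a x) w')) }.

Definition koszul (g : singularMetric) (X Y Z : M -> 'rV[R]_n) (p : M) : R :=
  2^-1 * (vact X (fun q => g q (Y q) (Z q)) p
          + vact Y (fun q => g q (Z q) (X q)) p
          - vact Z (fun q => g q (X q) (Y q)) p
          - g p (X p) (lie_bracket Y Z p)
          + g p (Y p) (lie_bracket Z X p)
          + g p (Z p) (lie_bracket X Y p)).

(* The semi-symmetric non-metric Koszul form associated with [P]. *)
Definition koszul_ssnm (g : singularMetric) (P X Y Z : M -> 'rV[R]_n) (p : M) :
  R := koszul g X Y Z p + g p (Y p) (P p) * g p (X p) (Z p).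

End Manifold.

(* The differential of [phi] at [p]. *)
Definition tmap (R : realType) (m n : nat) (M : smoothManifold R m)
    (N : smoothManifold R n) (phi : M -> N) (p : M) (v : 'rV[R]_m) : 'rV[R]_n :=
  'D_v (fun x => cmap (chart_at (phi p)) (phi (cinv (chart_at p) x)))
       (cmap (chart_at p) p).

Definition pullback (R : realType) (m n : nat) (M : smoothManifold R m)
    (N : smoothManifold R n) (phi : M -> N) (g : singularMetric N) (p : M)
    (u v : 'rV[R]_m) : R :=
  g (phi p) (tmap phi p u) (tmap phi p v).

Lemma open_preimage_lin (R : realType) (V V' : normedModType R)
  (l : V' -> V) (U : set V) : continuous l -> open U -> open (l @^-1` U).
Proof. by move=> lc oU; apply: open_comp => // x _; exact: lc. Qed.

Section Product.
Context {R : realType} {m n : nat}.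

Section prod_chart.
Context (M N : topologicalType) (a : chart R m M) (b : chart R n N).

Let pdom : set (M * N) := [set p | cdom a p.1 /\ cdom b p.2].
Let pimg : set 'rV[R]_(m + n) :=
  [set z | cimg a (lsubmx z) /\ cimg b (rsubmx z)].
Let pmap (p : M * N) : 'rV[R]_(m + n) := row_mx (cmap a p.1) (cmap b p.2).
Let pinv (z : 'rV[R]_(m + n)) : M * N := (cinv a (lsubmx z), cinv b (rsubmx z)).

Let pdom_open : open pdom.
Proof.
have -> : pdom = (fst @^-1` cdom a) `&` (snd @^-1` cdom b) by [].
apply: openI; apply: open_comp; try exact: cdom_open.
- by move=> p _; exact: cvg_fst.
- by move=> p _; exact: cvg_snd.
Qed.

Let pimg_open : open pimg.
Proof.
apply: openI; apply: open_preimage_lin; try exact: cimg_open.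
- exact: continuous_lsubmx.
- exact: continuous_rsubmx.
Qed.

Let pmap_img p : pdom p -> pimg (pmap p).
Proof.
by case=> p1 p2; rewrite /pimg /pmap /= row_mxKl row_mxKr; split; exact: cmap_img.
Qed.

Let pinv_dom z : pimg z -> pdom (pinv z).
Proof. by case=> z1 z2; split; exact: cinv_dom. Qed.

Let pmapK p : pdom p -> pinv (pmap p) = p.
Proof.
case: p => p q [/= p1 p2].
by rewrite /pinv /pmap row_mxKl row_mxKr !cmapK.
Qed.

Let pinvK z : pimg z -> pmap (pinv z) = z.
Proof. by case=> z1 z2; rewrite /pinv /pmap /= !cinvK// hsubmxK. Qed.

Let pmap_continuous p : pdom p -> {for p, continuous pmap}.
Proof.
case=> p1 p2; apply: continuous_row.
- by apply: (@continuous_comp _ _ _ fst (cmap a));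
    [exact: cvg_fst|exact: cmap_continuous].
- by apply: (@continuous_comp _ _ _ snd (cmap b));
    [exact: cvg_snd|exact: cmap_continuous].
Qed.

Let pinv_continuous z : pimg z -> {for z, continuous pinv}.
Proof.
case=> z1 z2.
have ca : {for z, continuous (cinv a \o lsubmx)}.
  by apply: continuous_comp; [exact: continuous_lsubmx|exact: cinv_continuous].
have cb : {for z, continuous (cinv b \o rsubmx)}.
  by apply: continuous_comp; [exact: continuous_rsubmx|exact: cinv_continuous].
exact: cvg_pair ca cb.
Qed.

Definition prod_chart : chart R (m + n) (M * N)%type :=
  Chart pdom_open pimg_open pmap_img pinv_dom pmapK pinvK
    pmap_continuous pinv_continuous.

End prod_chart.

Lemma prod_hausdorff (M N : topologicalType) :
  hausdorff_space M -> hausdorff_space N -> hausdorff_space (M * N)%type.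
Proof.
move=> hM hN [p q] [p' q'] cl; congr pair.
- apply: hM => A B pA p'B.
  have [||[x y] [/= Ax Bx]] := cl (fst @^-1` A) (fst @^-1` B).
  + by apply: (cvg_fst (F := nbhs p) (G := nbhs q)).
  + by apply: (cvg_fst (F := nbhs p') (G := nbhs q')).
  by exists x.
- apply: hN => A B pA p'B.
  have [||[x y] [/= Ax Bx]] := cl (snd @^-1` A) (snd @^-1` B).
  + by apply: (cvg_snd (F := nbhs p) (G := nbhs q)).
  + by apply: (cvg_snd (F := nbhs p') (G := nbhs q')).
  by exists y.
Qed.

Lemma prod_second_countable (M N : topologicalType) :
  @second_countable M -> @second_countable N ->
  @second_countable (M * N)%type.
Proof.
move=> [A cA [oA bA]] [B cB [oB bB]].
exists ((fun U => U.1 `*` U.2) @` (A `*` B)).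
  by apply: sub_countable (card_image_le _ _) _; exact: countableX.
split => [_ [[U V] [/= AU BV] <-]|[p q] W [[C D] /= [pC qD] CDW]].
  have -> : U `*` V = (fst @^-1` U) `&` (snd @^-1` V) by [].
  apply: openI; apply: open_comp; try by [exact: oA|exact: oB].
  - by move=> p _; exact: cvg_fst.
  - by move=> p _; exact: cvg_snd.
have [U [AU Up] UC] := bA p C pC; have [V [BV Vq] VD] := bB q D qD.
exists (U `*` V); first by split => //; exists (U, V).
by move=> [x y] [/= Ux Vy]; apply: CDW; split; [exact: UC|exact: VD].
Qed.

Variables (M : smoothManifold R m) (N : smoothManifold R n).

Let patlas : set (chart R (m + n) (M * N)%type) :=
  [set c | exists a b, [/\ atlas a, atlas b & c = @prod_chart M N a b]].

Let patlas_compat c d : patlas c -> patlas d ->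
  smooth_on (overlap c d) (transition c d).
Proof.
move=> [a [b [Aa Ab ->]]] [a' [b' [Aa' Ab' ->]]] k.
pose U := (lsubmx @^-1` overlap a a') `&` (rsubmx @^-1` overlap b b')
  : set 'rV[R]_(m + n).
apply: (@Ck_sub _ _ _ _ U) => [z [[? ?] [? ?]]|]; first by [].
change (Ck k U (fun z => row_mx ((transition a a' \o lsubmx) z)
                                ((transition b b' \o rsubmx) z))).
apply: Ck_row.
- apply: openI; apply: open_preimage_lin; try exact: overlap_open.
  + exact: continuous_lsubmx.
  + exact: continuous_rsubmx.
- apply: (@Ck_sub _ _ _ _ (lsubmx @^-1` overlap a a')) => [z []//|].
  exact: (Ck_complin (@continuous_lsubmx _ _ _ _) (atlas_compat Aa Aa' k)).
- apply: (@Ck_sub _ _ _ _ (rsubmx @^-1` overlap b b')) => [z []//|].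
  exact: (Ck_complin (@continuous_rsubmx _ _ _ _) (atlas_compat Ab Ab' k)).
Qed.

Let pchart_at (p : M * N) := prod_chart (chart_at p.1) (chart_at p.2).

Let pchart_at_atlas p : patlas (pchart_at p).
Proof.
by exists (chart_at p.1), (chart_at p.2); split=> //; exact: chart_at_atlas.
Qed.

Let pchart_at_dom p : cdom (pchart_at p) p.
Proof. by split; exact: chart_at_dom. Qed.

Definition prod_manifold : smoothManifold R (m + n) :=
  SmoothManifold (prod_hausdorff (@m_hausdorff _ _ M) (@m_hausdorff _ _ N))
    (prod_second_countable (@m_second_countable _ _ M)
                           (@m_second_countable _ _ N))
    patlas_compat pchart_at_atlas pchart_at_dom.

Lemma derive_prod_transition (a a' : chart R m M) (b b' : chart R n N) z w :
  atlas a -> atlas a' -> atlas b -> atlas b' ->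
  overlap a a' (lsubmx z) -> overlap b b' (rsubmx z) ->
  'D_w (transition (prod_chart a b) (prod_chart a' b')) z =
  row_mx ('D_(lsubmx w) (transition a a') (lsubmx z))
         ('D_(rsubmx w) (transition b b') (rsubmx z)).
Proof.
move=> Aa Aa' Ab Ab' za zb.
have [_ /(_ (lsubmx w))[/(_ _ za) da _]] := atlas_compat Aa Aa' 1%N.
have [_ /(_ (rsubmx w))[/(_ _ zb) db _]] := atlas_compat Ab Ab' 1%N.
rewrite -(derivable_complinE (@lsubmx R 1 m n)) in da.
rewrite -(derivable_complinE (@rsubmx R 1 m n)) in db.
have := derive_row da db.
by rewrite (derive_complin lsubmx) (derive_complin rsubmx).
Qed.

Definition proj1_manifold (p : prod_manifold) : M := p.1.
Definition proj2_manifold (p : prod_manifold) : N := p.2.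
End Product.

Section WarpedProduct.
Context {R : realType} {m n : nat}.
Context {B : smoothManifold R m} {F : smoothManifold R n}.
Local Notation BF := (prod_manifold B F).
Local Notation piB := (@proj1_manifold R m n B F).
Local Notation piF := (@proj2_manifold R m n B F).

Lemma tmap_proj1 p v : tmap piB p v = lsubmx v.
Proof.
case: p => p q; pose U := lsubmx @^-1` cimg (chart_at p) : set 'rV[R]_(m + n).
rewrite [LHS](@eq_derive_open _ _ _ U _ (id \o @lsubmx R 1 m n)).
- by rewrite derive_complin derive_id.
- by apply: open_preimage_lin; [exact: continuous_lsubmx|exact: cimg_open].
- by rewrite /U /= row_mxKl; apply: cmap_img; exact: chart_at_dom.
- by move=> z Uz /=; rewrite cinvK.
Qed.

Lemma tmap_proj2 p v : tmap piF p v = rsubmx v.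
Proof.
case: p => p q; pose U := rsubmx @^-1` cimg (chart_at q) : set 'rV[R]_(m + n).
rewrite [LHS](@eq_derive_open _ _ _ U _ (id \o @rsubmx R 1 m n)).
- by rewrite derive_complin derive_id.
- by apply: open_preimage_lin; [exact: continuous_rsubmx|exact: cimg_open].
- by rewrite /U /= row_mxKr; apply: cmap_img; exact: chart_at_dom.
- by move=> z Uz /=; rewrite cinvK.
Qed.

Let liftB_section (X : B -> 'rV[R]_m) (p : BF) : 'rV[R]_(m + n) :=
  row_mx (X (piB p)) 0.

Let liftF_section (V : F -> 'rV[R]_n) (p : BF) : 'rV[R]_(m + n) :=
  row_mx 0 (V (piF p)).

Lemma tcoord_prod (a : chart R m B) (b : chart R n F) (p : BF) w :
  atlas a -> atlas b -> cdom a p.1 -> cdom b p.2 ->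
  tcoord (prod_chart a b : chart R (m + n) BF) p w =
  row_mx (tcoord a p.1 (lsubmx w)) (tcoord b p.2 (rsubmx w)).
Proof.
move=> Aa Ab pa pb; rewrite [LHS]derive_prod_transition ?row_mxKl ?row_mxKr//.
- exact: chart_at_atlas.
- exact: chart_at_atlas.
- have pp := chart_at_dom p.1.
  by split; [exact: cmap_img|rewrite /= cmapK].
- have pp := chart_at_dom p.2.
  by split; [exact: cmap_img|rewrite /= cmapK].
Qed.

Lemma tvec_prod (a : chart R m B) (b : chart R n F) (p : BF) w :
  atlas a -> atlas b -> cdom a p.1 -> cdom b p.2 ->
  tvec (prod_chart a b : chart R (m + n) BF) p w =
  row_mx (tvec a p.1 (lsubmx w)) (tvec b p.2 (rsubmx w)).
Proof.
move=> Aa Ab pa pb; rewrite [LHS]derive_prod_transition ?row_mxKl ?row_mxKr//.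
- exact: chart_at_atlas.
- exact: chart_at_atlas.
- have pp := chart_at_dom p.1.
  by split; [exact: cmap_img|rewrite /= cmapK].
- have pp := chart_at_dom p.2.
  by split; [exact: cmap_img|rewrite /= cmapK].
Qed.

Lemma tcoord0 k (M : smoothManifold R k) (a : chart R k M) p : tcoord a p 0 = 0.
Proof. exact: derive0. Qed.

Let liftB_smooth (X : vfield B) : smooth_section (liftB_section X).
Proof.
move=> _ [a [b [Aa Ab ->]]] k.
pose rep := fun z : 'rV[R]_(m + n) =>
  row_mx ((section_rep X a \o lsubmx) z) (0 : 'rV[R]_n).
apply: (@eq_Ck _ _ _ k _ rep); first exact: cimg_open.
  move=> z [za zb]; apply/esym/(etrans (tcoord_prod _ Aa Ab _ _)).
  - exact: cinv_dom.
  - exact: cinv_dom.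
  by rewrite /= row_mxKl row_mxKr tcoord0.
apply: Ck_row; [exact: cimg_open| |exact: Ck_cst].
apply: (@Ck_sub _ _ _ _ (lsubmx @^-1` cimg a)) => [z []//|].
exact: (Ck_complin (@continuous_lsubmx _ _ _ _) (vf_smooth X Aa k)).
Qed.

Let liftF_smooth (V : vfield F) : smooth_section (liftF_section V).
Proof.
move=> _ [a [b [Aa Ab ->]]] k.
pose rep := fun z : 'rV[R]_(m + n) =>
  row_mx (0 : 'rV[R]_m) ((section_rep V b \o rsubmx) z).
apply: (@eq_Ck _ _ _ k _ rep); first exact: cimg_open.
  move=> z [za zb]; apply/esym/(etrans (tcoord_prod _ Aa Ab _ _)).
  - exact: cinv_dom.
  - exact: cinv_dom.
  by rewrite /= row_mxKl row_mxKr tcoord0.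
apply: Ck_row; [exact: cimg_open|exact: Ck_cst|].
apply: (@Ck_sub _ _ _ _ (rsubmx @^-1` cimg b)) => [z []//|].
exact: (Ck_complin (@continuous_rsubmx _ _ _ _) (vf_smooth V Ab k)).
Qed.

(* The lift to [BF] of a vector field on [B] (resp. [F]) is the vector field
   projected to it by d(piB) (resp. d(piF)) and to 0 by the differential of the
   other projection, see [liftBP] and [liftFP]. *)
Definition liftB (X : vfield B) : vfield BF := VField (liftB_smooth X).

Definition liftF (V : vfield F) : vfield BF := VField (liftF_smooth V).

Lemma liftBP (X : vfield B) p :
  tmap piB p (liftB X p) = X (piB p) /\ tmap piF p (liftB X p) = 0.
Proof. by rewrite tmap_proj1 tmap_proj2 /= row_mxKl row_mxKr. Qed.

Lemma liftFP (V : vfield F) p :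
  tmap piB p (liftF V p) = 0 /\ tmap piF p (liftF V p) = V (piF p).
Proof. by rewrite tmap_proj1 tmap_proj2 /= row_mxKl row_mxKr. Qed.

Section warped_metric.
Variables (gB : singularMetric B) (gF : singularMetric F).
Variables (f : B -> R) (f_smooth : smooth_fun f).

Let wform (p : BF) (u v : 'rV[R]_(m + n)) : R :=
  pullback piB gB p u v + f (piB p) ^+ 2 * pullback piF gF p u v.

Let wformE p u v : wform p u v =
  gB (piB p) (lsubmx u) (lsubmx v) +
  f (piB p) ^+ 2 * gF (piF p) (rsubmx u) (rsubmx v).
Proof.
rewrite /wform /pullback (tmap_proj1 p u) (tmap_proj1 p v).
by rewrite (tmap_proj2 p u) (tmap_proj2 p v).
Qed.

Let wform_row p u u' v v' : wform p (row_mx u u') (row_mx v v') =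
  gB (piB p) u v + f (piB p) ^+ 2 * gF (piF p) u' v'.
Proof. by rewrite wformE !row_mxKl !row_mxKr. Qed.

Let wform_sym p u v : wform p u v = wform p v u.
Proof.
by rewrite !wformE (mform_sym gB) (mform_sym gF).
Qed.

Let wform_linear p (c : R) u u' v :
  wform p (c *: u + u') v = c * wform p u v + wform p u' v.
Proof.
rewrite !wformE !linearP !mform_linear.
by rewrite !mulrDr addrACA mulrCA.
Qed.

Let wform_smooth (c : chart R (m + n) BF) : atlas c -> forall w w',
  smooth_on (cimg c) (fun x =>
    wform (cinv c x) (tvec c (cinv c x) w) (tvec c (cinv c x) w')).
Proof.
move=> [a [b [Aa Ab ->]]] w w' k.
pose hB x := gB (cinv a x) (tvec a (cinv a x) (lsubmx w))
                           (tvec a (cinv a x) (lsubmx w')).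
pose hF x := gF (cinv b x) (tvec b (cinv b x) (rsubmx w))
                           (tvec b (cinv b x) (rsubmx w')).
pose hf x := f (cinv a x).
have oc : open (cimg (prod_chart a b)) by exact: cimg_open.
have sB : cimg (prod_chart a b) `<=` lsubmx @^-1` cimg a by move=> z [].
have sF : cimg (prod_chart a b) `<=` rsubmx @^-1` cimg b by move=> z [].
have CB : Ck k (cimg (prod_chart a b)) (hB \o lsubmx).
  exact: Ck_sub sB (Ck_complin (@continuous_lsubmx _ _ _ _)
    (mform_smooth gB Aa (lsubmx w) (lsubmx w') k)).
have CF : Ck k (cimg (prod_chart a b)) (hF \o rsubmx).
  exact: Ck_sub sF (Ck_complin (@continuous_rsubmx _ _ _ _)
    (mform_smooth gF Ab (rsubmx w) (rsubmx w') k)).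
have Cf : Ck k (cimg (prod_chart a b)) (hf \o lsubmx).
  exact: Ck_sub sB (Ck_complin (@continuous_lsubmx _ _ _ _) (f_smooth Aa k)).
apply: eq_Ck oc _ (CkD oc CB (CkM oc (CkM oc Cf Cf) CF)) => z [za zb].
have da := cinv_dom za; have db := cinv_dom zb.
set p : BF := (cinv a (lsubmx z), cinv b (rsubmx z)).
have Ew := tvec_prod (p := p) w Aa Ab da db.
have Ew' := tvec_prod (p := p) w' Aa Ab da db.
apply/esym/(etrans (congr2 (wform p) Ew Ew')).
by apply: (etrans (wform_row p _ _ _ _)); rewrite expr2.
Qed.

(* piB^*(gB) + (f \o piB)^2 piF^*(gF); [f] may vanish. *)
Definition warped_metric : singularMetric BF :=
  SingularMetric wform_sym wform_linear wform_smooth.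

End warped_metric.
End WarpedProduct.

(* Main.v *)
(* On B x_f F the lifts of X and V act on a function h as X on h(-, q) and V on
   h(p, -), the brackets of lifts are [X, Y] and [V, W], lifted, and
   [X, V] = 0, while g(X, Y) = g_B(X, Y), g(X, V) = 0 and
   g(V, W) = f^2 g_F(V, W). In the mixed components only
   X(f^2 g_F(V, W)) = 2 f X(f) g_F(V, W) and the P-term survive. *)
Require Import Defs.
From mathcomp Require Import all_boot all_order all_algebra.
From mathcomp Require Import all_classical all_reals.
From mathcomp Require Import topology normedtype derive.
From mathcomp Require Import ring.

Set Implicit Arguments.
Unset Strict Implicit.
Unset Printing Implicit Defensive.

Import GRing.Theory.
Import numFieldNormedType.Exports.
Local Open Scope ring_scope.

(** * Directional derivatives under scaling and in block coordinates *)

Section derive_facts.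
Context {R : realType}.

(* No derivability assumption: when the difference quotients diverge, both
   sides are the junk value 0 of [lim]. *)
Lemma deriveMl_total (V : normedModType R) (c : R) (h : V -> R) x v :
  'D_v (fun y => c * h y) x = c * 'D_v h x.
Proof.
have [dh|ndh] := pselect (derivable h x v); first exact: (deriveZ c dh).
have [->|c0] := eqVneq c 0.
  rewrite mul0r; under eq_fun do rewrite mul0r.
  exact: derive_cst.
have ndch : ~ derivable (fun y => c * h y) x v.
  move=> /(derivableZ (k := c^-1)) dch; apply: ndh.
  rewrite (_ : h = c^-1 \*: (fun y => c * h y)) //.
  by apply/funext => y /=; rewrite /GRing.scale/= mulKf.
by rewrite /derive (dvgP ndch) (dvgP ndh) mulr0.
Qed.

(** Moving along [row_mx u 0] leaves the second block fixed, so both difference quotients are the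
    same function of the increment, whatever [h] is. *)
Lemma derive_row_mxl m n (W : normedModType R) (h : 'rV[R]_(m + n) -> W) x y u :
  'D_(row_mx u 0) h (row_mx x y) = 'D_u (fun x' => h (row_mx x' y)) x.
Proof.
rewrite /derive /=.
by under eq_fun do rewrite scale_row_mx scaler0 add_row_mx add0r.
Qed.

Lemma derive_row_mxr m n (W : normedModType R) (h : 'rV[R]_(m + n) -> W) x y v :
  'D_(row_mx 0 v) h (row_mx x y) = 'D_v (fun y' => h (row_mx x y')) y.
Proof.
rewrite /derive /=.
by under eq_fun do rewrite scale_row_mx scaler0 add_row_mx add0r.
Qed.

End derive_facts.

(** * Vector fields acting on functions, and evaluation of the Koszul form *)

Section vact_facts.
Context {R : realType} {n : nat} (M : smoothManifold R n).
Implicit Types (X : M -> 'rV[R]_n) (p : M).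

Lemma vact_cst X (c : R) p : vact X (fun=> c) p = 0.
Proof. exact: derive_cst. Qed.

(** For arbitrary [h], hence directly applicable to a metric evaluated on two fields. *)
Lemma vactMl X (c : R) (h : M -> R) p :
  vact X (fun q => c * h q) p = c * vact X h p.
Proof. exact: deriveMl_total. Qed.

Lemma vact_sqr X (h : M -> R) p : smooth_fun h ->
  vact X (fun q => h q ^+ 2) p = 2 * h p * vact X h p.
Proof.
(* Smoothness at order 1 in the preferred chart gives derivability along [X p], as the Leibniz rule
   requires. *)
move=> /(_ _ (chart_at_atlas p) 1%N)[_ /(_ (X p))[dh _]].
have cp := chart_at_dom p.
have {}dh := dh _ (cmap_img cp).
rewrite /vact; under eq_fun do rewrite expr2.
by rewrite (deriveM dh dh) /= cmapK // -[RHS]mulrA mulr_natl mulr2n.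
Qed.

(** Reduces each component to eight values: three derivatives, three bracket terms, and the two
    factors of the [P]-term. *)
Lemma koszul_ssnmE (g : singularMetric M) (P X Y Z : M -> 'rV[R]_n) p
    a b c d e i j k :
  vact X (fun q => g q (Y q) (Z q)) p = a ->
  vact Y (fun q => g q (Z q) (X q)) p = b ->
  vact Z (fun q => g q (X q) (Y q)) p = c ->
  g p (X p) (lie_bracket Y Z p) = d ->
  g p (Y p) (lie_bracket Z X p) = e ->
  g p (Z p) (lie_bracket X Y p) = i ->
  g p (Y p) (P p) = j -> g p (X p) (Z p) = k ->
  koszul_ssnm g P X Y Z p = 2^-1 * (a + b - c - d + e + i) + j * k.
Proof. by rewrite /koszul_ssnm /koszul => -> -> -> -> -> -> -> ->. Qed.

Lemma mform0l (g : singularMetric M) p v : g p 0 v = 0.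
Proof.
(* With [c = -1] and both vectors zero, the right-hand side of linearity cancels itself. *)
have := mform_linear g p (-1) 0 0 v.
by rewrite scaler0 addr0 mulN1r addNr.
Qed.

Lemma mform0r (g : singularMetric M) p v : g p v 0 = 0.
Proof. by rewrite mform_sym mform0l. Qed.

End vact_facts.

(** * Action and Lie brackets of lifted vector fields *)

Section lifts.
Context {R : realType} {m n : nat}.
Context {B : smoothManifold R m} {F : smoothManifold R n}.
Local Notation BF := (prod_manifold B F).
Local Notation lB := (@liftB R m n B F).
Local Notation lF := (@liftF R m n B F).
Implicit Types (X Y : vfield B) (V W : vfield F) (h : BF -> R).

(** The preferred chart at [(p, q)] is the product of the preferred charts, and there the lift has
    components [row_mx (X p) 0]; only the slice through [q] is seen. *)
Lemma vact_liftB X h p q :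
  vact (lB X) h (p, q) = vact X (fun p' => h (p', q)) p.
Proof.
pose k z := h (cinv (chart_at ((p, q) : BF)) z).
apply: (etrans (@derive_row_mxl R m n _ k (cmap (chart_at p) p)
  (cmap (chart_at q) q) (X p))).
apply: (congr1 (fun k' => 'D_(X p) k' _)); apply/funext => x.
have -> : (cinv (chart_at p) x, q) = cinv (chart_at ((p, q) : BF))
    (row_mx x (cmap (chart_at q) q)).
  by rewrite /= row_mxKl row_mxKr cmapK //; exact: chart_at_dom.
by [].
Qed.

Lemma vact_liftF V h p q :
  vact (lF V) h (p, q) = vact V (fun q' => h (p, q')) q.
Proof.
pose k z := h (cinv (chart_at ((p, q) : BF)) z).
apply: (etrans (@derive_row_mxr R m n _ k (cmap (chart_at p) p)
  (cmap (chart_at q) q) (V q))).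
apply: (congr1 (fun k' => 'D_(V q) k' _)); apply/funext => x.
have -> : (p, cinv (chart_at q) x) = cinv (chart_at ((p, q) : BF))
    (row_mx (cmap (chart_at p) p) x).
  by rewrite /= row_mxKl row_mxKr cmapK //; exact: chart_at_dom.
by [].
Qed.

(** In a product chart the lift is represented by [section_rep X] of the first block, next to a
    constant zero block. *)
Lemma derive_section_rep_liftB X (p : BF) w :
  'D_w (section_rep (lB X) (chart_at p)) (cmap (chart_at p) p) =
  row_mx
    ('D_(lsubmx w) (section_rep X (chart_at p.1)) (cmap (chart_at p.1) p.1)) 0.
Proof.
pose rep (z : 'rV[R]_(m + n)) :=
  row_mx ((section_rep X (chart_at p.1) \o lsubmx) z) (0 : 'rV[R]_n).
have cp := cmap_img (chart_at_dom p).
rewrite (eq_derive_open (g := rep) w (@cimg_open _ _ _ (chart_at p)) cp);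
  last first.
  move=> z [z1 z2].
  apply: (etrans (tcoord_prod _ (chart_at_atlas p.1) (chart_at_atlas p.2) _ _)).
  - exact: cinv_dom.
  - exact: cinv_dom.
  by rewrite /= row_mxKl row_mxKr tcoord0.
rewrite derive_row ?derive_cst ?derive_complin /= ?row_mxKl //.
rewrite derivable_complinE /= row_mxKl.
have [_ /(_ (lsubmx w))[+ _]] := vf_smooth X (chart_at_atlas p.1) 1%N.
by apply; exact: cmap_img (chart_at_dom _).
Qed.

Lemma derive_section_rep_liftF V (p : BF) w :
  'D_w (section_rep (lF V) (chart_at p)) (cmap (chart_at p) p) =
  row_mx 0
    ('D_(rsubmx w) (section_rep V (chart_at p.2)) (cmap (chart_at p.2) p.2)).
Proof.
pose rep (z : 'rV[R]_(m + n)) :=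
  row_mx (0 : 'rV[R]_m) ((section_rep V (chart_at p.2) \o rsubmx) z).
have cp := cmap_img (chart_at_dom p).
(* The two representations agree on the open image of the chart, where [cinv] is meaningful; this
   suffices for derivatives at a point of it. *)
rewrite (eq_derive_open (g := rep) w (@cimg_open _ _ _ (chart_at p)) cp);
  last first.
  move=> z [z1 z2].
  apply: (etrans (tcoord_prod _ (chart_at_atlas p.1) (chart_at_atlas p.2) _ _)).
  - exact: cinv_dom.
  - exact: cinv_dom.
  by rewrite /= row_mxKl row_mxKr tcoord0.
rewrite derive_row ?derive_cst ?derive_complin /= ?row_mxKr //.
rewrite derivable_complinE /= row_mxKr.
have [_ /(_ (rsubmx w))[+ _]] := vf_smooth V (chart_at_atlas p.2) 1%N.
by apply; exact: cmap_img (chart_at_dom _).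
Qed.

Lemma lie_bracket_liftB X Y p q :
  lie_bracket (lB X) (lB Y) (p, q) = row_mx (lie_bracket X Y p) 0.
Proof.
apply: (etrans (congr2 (fun u v => u - v)
  (derive_section_rep_liftB Y (p, q) _)
  (derive_section_rep_liftB X (p, q) _))).
by rewrite /= !row_mxKl opp_row_mx add_row_mx subr0.
Qed.

Lemma lie_bracket_liftF V W p q :
  lie_bracket (lF V) (lF W) (p, q) = row_mx 0 (lie_bracket V W q).
Proof.
apply: (etrans (congr2 (fun u v => u - v)
  (derive_section_rep_liftF W (p, q) _)
  (derive_section_rep_liftF V (p, q) _))).
by rewrite /= !row_mxKr opp_row_mx add_row_mx subr0.
Qed.

(** Each representative depends only on the block in which the other field vanishes, so both terms
    are derivatives along 0. *)
Lemma lie_bracket_liftBF X V p q :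
  lie_bracket (lB X) (lF V) (p, q) = 0.
Proof.
apply: (etrans (congr2 (fun u v => u - v)
  (derive_section_rep_liftF V (p, q) _)
  (derive_section_rep_liftB X (p, q) _))).
by rewrite /= row_mxKl row_mxKr !derive0 row_mx0 subr0.
Qed.

Lemma lie_bracket_liftFB V X p q :
  lie_bracket (lF V) (lB X) (p, q) = 0.
Proof.
apply: (etrans (congr2 (fun u v => u - v)
  (derive_section_rep_liftB X (p, q) _)
  (derive_section_rep_liftF V (p, q) _))).
by rewrite /= row_mxKl row_mxKr !derive0 row_mx0 subr0.
Qed.

(** * The warped metric on lifts, its derivatives, and its pairing with brackets *)

Section warped_metric.
Variables (gB : singularMetric B) (gF : singularMetric F).
Variables (f : B -> R) (f_smooth : smooth_fun f).
Local Notation g := (warped_metric gB gF f_smooth).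

Lemma warped_metric_row p q u u' v v' :
  g (p, q) (row_mx u v) (row_mx u' v') = gB p u u' + f p ^+ 2 * gF q v v'.
Proof.
rewrite /= /pullback !tmap_proj1 !tmap_proj2.
by rewrite !row_mxKl !row_mxKr.
Qed.

Lemma warped_metric_liftB X Y p q :
  g (p, q) (lB X (p, q)) (lB Y (p, q)) = gB p (X p) (Y p).
Proof. by rewrite [LHS]warped_metric_row mform0l mulr0 addr0. Qed.

Lemma warped_metric_liftF V W p q :
  g (p, q) (lF V (p, q)) (lF W (p, q)) = f p ^+ 2 * gF q (V q) (W q).
Proof. by rewrite [LHS]warped_metric_row mform0l add0r. Qed.

Lemma warped_metric_liftBF X V p q :
  g (p, q) (lB X (p, q)) (lF V (p, q)) = 0.
Proof. by rewrite [LHS]warped_metric_row mform0r mform0l mulr0 addr0. Qed.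

Lemma warped_metric_liftFB V X p q :
  g (p, q) (lF V (p, q)) (lB X (p, q)) = 0.
Proof. by rewrite mform_sym; exact: warped_metric_liftBF. Qed.

Lemma vact_warped_metric_BBB X Y Z p q :
  vact (lB X) (fun r => g r (lB Y r) (lB Z r)) (p, q) =
  vact X (fun p => gB p (Y p) (Z p)) p.
Proof.
apply: (etrans (vact_liftB X _ p q)).
under eq_fun do rewrite warped_metric_liftB.
by [].
Qed.

(** On lifts from the base the metric is constant along each fibre. *)
Lemma vact_warped_metric_FBB V X Y p q :
  vact (lF V) (fun r => g r (lB X r) (lB Y r)) (p, q) = 0.
Proof.
apply: (etrans (vact_liftF V _ p q)).
under eq_fun do rewrite warped_metric_liftB.
exact: vact_cst.
Qed.

(** The source of every [X(f)] term: along the base [gF q (V q) (W q)] is frozen and only the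
    squared warping function varies. *)
Lemma vact_warped_metric_BFF X V W p q :
  vact (lB X) (fun r => g r (lF V r) (lF W r)) (p, q) =
  2 * f p * vact X f p * gF q (V q) (W q).
Proof.
apply: (etrans (vact_liftB X _ p q)).
under eq_fun do rewrite warped_metric_liftF.
under eq_fun do rewrite mulrC.
by rewrite vactMl vact_sqr // mulrC.
Qed.

Lemma vact_warped_metric_FFF U V W p q :
  vact (lF U) (fun r => g r (lF V r) (lF W r)) (p, q) =
  f p ^+ 2 * vact U (fun q => gF q (V q) (W q)) q.
Proof.
apply: (etrans (vact_liftF U _ p q)).
under eq_fun do rewrite warped_metric_liftF.
exact: vactMl.
Qed.

(** Orthogonality of the factors makes the differentiated function identically zero, so [T] may be a
    lift from either factor. *)
Lemma vact_warped_metric_BF (T : BF -> 'rV[R]_(m + n)) X V p q :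
  vact T (fun r => g r (lB X r) (lF V r)) (p, q) = 0.
Proof.
rewrite [X in vact _ X _](_ : _ = fun=> 0); first exact: vact_cst.
by apply/funext => -[p' q']; exact: warped_metric_liftBF.
Qed.

Lemma vact_warped_metric_FB (T : BF -> 'rV[R]_(m + n)) V X p q :
  vact T (fun r => g r (lF V r) (lB X r)) (p, q) = 0.
Proof.
rewrite [X in vact _ X _](_ : _ = fun=> 0); first exact: vact_cst.
by apply/funext => -[p' q']; exact: warped_metric_liftFB.
Qed.

Lemma warped_metric_bracket_BBB X Y Z p q :
  g (p, q) (lB X (p, q)) (lie_bracket (lB Y) (lB Z) (p, q)) =
  gB p (X p) (lie_bracket Y Z p).
Proof.
rewrite lie_bracket_liftB.
by rewrite [LHS]warped_metric_row mform0l mulr0 addr0.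
Qed.

Lemma warped_metric_bracket_BFF X V W p q :
  g (p, q) (lB X (p, q)) (lie_bracket (lF V) (lF W) (p, q)) = 0.
Proof.
rewrite lie_bracket_liftF.
by rewrite [LHS]warped_metric_row mform0r mform0l mulr0 addr0.
Qed.

Lemma warped_metric_bracket_FBB V X Y p q :
  g (p, q) (lF V (p, q)) (lie_bracket (lB X) (lB Y) (p, q)) = 0.
Proof.
rewrite lie_bracket_liftB.
by rewrite [LHS]warped_metric_row mform0r mform0l mulr0 addr0.
Qed.

Lemma warped_metric_bracket_FFF U V W p q :
  g (p, q) (lF U (p, q)) (lie_bracket (lF V) (lF W) (p, q)) =
  f p ^+ 2 * gF q (U q) (lie_bracket V W q).
Proof.
rewrite lie_bracket_liftF.
by rewrite [LHS]warped_metric_row mform0l add0r.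
Qed.

Lemma warped_metric_bracket_BF X V u p q :
  g (p, q) u (lie_bracket (lB X) (lF V) (p, q)) = 0.
Proof. by rewrite lie_bracket_liftBF mform0r. Qed.

Lemma warped_metric_bracket_FB V X u p q :
  g (p, q) u (lie_bracket (lF V) (lB X) (p, q)) = 0.
Proof. by rewrite lie_bracket_liftFB mform0r. Qed.

End warped_metric.

End lifts.

(** * Assembly of the components of the Koszul form *)

Theorem proposition3p13 (R : realType) (m n : nat)
  (B : smoothManifold R m) (F : smoothManifold R n)
  (gB : singularMetric B) (gF : singularMetric F)
  (f : B -> R) (f_smooth : smooth_fun f)
  (X Y Z P : vfield B) (U V W : vfield F)
  (p : B) (q : F) :
  let pq : prod_manifold B F := (p, q) in
  let lB (T : vfield B) : vfield (prod_manifold B F) := liftB T in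
  let lF (T : vfield F) : vfield (prod_manifold B F) := liftF T in
  let K := koszul_ssnm (warped_metric gB gF f_smooth) (lB P) in
  [/\ K (lB X) (lB Y) (lB Z) pq = koszul_ssnm gB P X Y Z p,
      [/\ K (lB X) (lB Y) (lF W) pq = 0,
          K (lB X) (lF W) (lB Y) pq = 0 &
          K (lF W) (lB X) (lB Y) pq = 0],
      K (lB X) (lF V) (lF W) pq = - K (lF V) (lF W) (lB X) pq /\
      - K (lF V) (lF W) (lB X) pq = f p * gF q (V q) (W q) * vact X f p,
      K (lF V) (lB X) (lF W) pq =
        f p * gF q (V q) (W q) * vact X f p +
        f p ^+ 2 * gB p (X p) (P p) * gF q (V q) (W q) &
      K (lF U) (lF V) (lF W) pq = f p ^+ 2 * koszul gF U V W q].
Proof.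
move=> pq lB lF K.
have KXYZ := koszul_ssnmE
    (vact_warped_metric_BBB gB gF f_smooth X Y Z p q)
    (vact_warped_metric_BBB gB gF f_smooth Y Z X p q)
    (vact_warped_metric_BBB gB gF f_smooth Z X Y p q)
    (warped_metric_bracket_BBB gB gF f_smooth X Y Z p q)
    (warped_metric_bracket_BBB gB gF f_smooth Y Z X p q)
    (warped_metric_bracket_BBB gB gF f_smooth Z X Y p q)
    (warped_metric_liftB gB gF f_smooth Y P p q)
    (warped_metric_liftB gB gF f_smooth X Z p q).
(* In the three components with a single fibre field, the first six values are zero, and the
   [P]-term has a factor pairing a base lift with a fibre lift. *)
have KXYW := koszul_ssnmE
    (vact_warped_metric_BF gB gF f_smooth _ Y W p q)
    (vact_warped_metric_FB gB gF f_smooth _ W X p q)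
    (vact_warped_metric_FBB gB gF f_smooth W X Y p q)
    (warped_metric_bracket_BF gB gF f_smooth Y W _ p q)
    (warped_metric_bracket_FB gB gF f_smooth W X _ p q)
    (warped_metric_bracket_FBB gB gF f_smooth W X Y p q)
    (warped_metric_liftB gB gF f_smooth Y P p q)
    (warped_metric_liftBF gB gF f_smooth X W p q).
have KXWY := koszul_ssnmE
    (vact_warped_metric_FB gB gF f_smooth _ W Y p q)
    (vact_warped_metric_FBB gB gF f_smooth W Y X p q)
    (vact_warped_metric_BF gB gF f_smooth _ X W p q)
    (warped_metric_bracket_FB gB gF f_smooth W Y _ p q)
    (warped_metric_bracket_FBB gB gF f_smooth W Y X p q)
    (warped_metric_bracket_BF gB gF f_smooth X W _ p q)
    (warped_metric_liftFB gB gF f_smooth W P p q)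
    (warped_metric_liftB gB gF f_smooth X Y p q).
have KWXY := koszul_ssnmE
    (vact_warped_metric_FBB gB gF f_smooth W X Y p q)
    (vact_warped_metric_BF gB gF f_smooth _ Y W p q)
    (vact_warped_metric_FB gB gF f_smooth _ W X p q)
    (warped_metric_bracket_FBB gB gF f_smooth W X Y p q)
    (warped_metric_bracket_BF gB gF f_smooth Y W _ p q)
    (warped_metric_bracket_FB gB gF f_smooth W X _ p q)
    (warped_metric_liftB gB gF f_smooth X P p q)
    (warped_metric_liftFB gB gF f_smooth W Y p q).
have KXVW := koszul_ssnmE
    (vact_warped_metric_BFF gB gF f_smooth X V W p q)
    (vact_warped_metric_FB gB gF f_smooth _ W X p q)
    (vact_warped_metric_BF gB gF f_smooth _ X V p q)
    (warped_metric_bracket_BFF gB gF f_smooth X V W p q)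
    (warped_metric_bracket_FB gB gF f_smooth W X _ p q)
    (warped_metric_bracket_BF gB gF f_smooth X V _ p q)
    (warped_metric_liftFB gB gF f_smooth V P p q)
    (warped_metric_liftBF gB gF f_smooth X W p q).
have KVWX := koszul_ssnmE
    (vact_warped_metric_FB gB gF f_smooth _ W X p q)
    (vact_warped_metric_BF gB gF f_smooth _ X V p q)
    (vact_warped_metric_BFF gB gF f_smooth X V W p q)
    (warped_metric_bracket_FB gB gF f_smooth W X _ p q)
    (warped_metric_bracket_BF gB gF f_smooth X V _ p q)
    (warped_metric_bracket_BFF gB gF f_smooth X V W p q)
    (warped_metric_liftFB gB gF f_smooth W P p q)
    (warped_metric_liftFB gB gF f_smooth V X p q).
(* The one mixed component whose [P]-term survives: its factors are [gB p (X p) (P p)] and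
   [f p ^+ 2 * gF q (V q) (W q)]. *)
have KVXW := koszul_ssnmE
    (vact_warped_metric_BF gB gF f_smooth _ X W p q)
    (vact_warped_metric_BFF gB gF f_smooth X W V p q)
    (vact_warped_metric_FB gB gF f_smooth _ V X p q)
    (warped_metric_bracket_BF gB gF f_smooth X W _ p q)
    (warped_metric_bracket_BFF gB gF f_smooth X W V p q)
    (warped_metric_bracket_FB gB gF f_smooth V X _ p q)
    (warped_metric_liftB gB gF f_smooth X P p q)
    (warped_metric_liftF gB gF f_smooth V W p q).
have KUVW := koszul_ssnmE
    (vact_warped_metric_FFF gB gF f_smooth U V W p q)
    (vact_warped_metric_FFF gB gF f_smooth V W U p q)
    (vact_warped_metric_FFF gB gF f_smooth W U V p q)
    (warped_metric_bracket_FFF gB gF f_smooth U V W p q)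
    (warped_metric_bracket_FFF gB gF f_smooth V W U p q)
    (warped_metric_bracket_FFF gB gF f_smooth W U V p q)
    (warped_metric_liftFB gB gF f_smooth V P p q)
    (warped_metric_liftF gB gF f_smooth U W p q).
split.
- exact: KXYZ.
- by split; [rewrite [LHS]KXYW|rewrite [LHS]KXWY|rewrite [LHS]KWXY]; ring.
- split; [rewrite [LHS]KXVW [X in _ = - X]KVWX|rewrite [X in - X = _]KVWX].
    by field.
  by field.
(* The derivative term carries [W] before [V], by the cyclic order of the Koszul formula; symmetry
   of [gF] aligns it with the [P]-term. *)
- by rewrite [LHS]KVXW (mform_sym gF q (W q)); field.
- apply: (etrans KUVW); rewrite /koszul; set c := f p ^+ 2.
  (* The factor [0] before [k] is the pairing of [V] with the base field [P]; the other six terms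
     share the factor [c]. *)
  have scale (a b d e i j k : R) : 2^-1 * (c * a + c * b - c * d - c * e +
      c * i + c * j) + 0 * k = c * (2^-1 * (a + b - d - e + i + j)) by ring.
  exact: scale.
Qed.
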